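(* Let $m\ge 1$, let $n_1,\dots,n_C\ge 1$ be integers with $\sum_{c=1}^C n_c=m$, and let $L_{SC}=\mathrm{blkdiag}(L_1,\dots,L_C)\in\mathbb{R}^{m\times m}$, where $L_c=n_c\mathbb I_{n_c}-\mathbf 1_{n_c}\mathbf 1_{n_c}^{T}$. Let $\rho\in(0,1]$ and let $\theta=\mu+Zu\in\mathbb{R}^m$, where $\mu\in\mathbb{R}^m$, $Z\in\mathbb{R}^{m\times h}$ and $u\in\mathbb{R}^h$. Consider the convex differentiable objective function $$F(\vartheta)=\rho(\vartheta-\theta)^{T}(\vartheta-\theta)+(1-\rho)\,\vartheta^{T}L_{SC}\,\vartheta,\qquad \vartheta\in\mathbb{R}^m .$$ Then the matrix $$A_\rho=\mathbb I_m+\frac{1-\rho}{\rho}L_{SC}\in\mathbb{R}^{m\times m}$$ is symmetric and positive definite, and the minimizer of $F$ over $\mathbb{R}^m$ is $$\theta^{SC}=A_\rho^{-1}\theta .$$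
   Context: $\mathbb I_k$ is the $k\times k$ identity matrix, $\mathbf 1_k$ is the column vector of $k$ ones, and $\mathrm{blkdiag}$ denotes the block-diagonal matrix with the given blocks. The $m$ small areas are partitioned into $C\le m$ clusters, cluster $c$ having $n_c$ areas, and areas are ordered so that clusters are contiguous; $L_{SC}$ is the graph Laplacian of the disjoint union of complete graphs on the clusters. The vector $\theta$ is the small area parameter vector of a linear mixed model $y=\theta+e$, $\theta=\mu+Zu$, with $Z$ a known full rank design matrix; $\rho$ is called the cluster regularization penalty. *)

(* Defs.v *)
From HB Require Import structures.
From mathcomp Require Import all_boot all_order all_algebra.
From mathcomp Require Import all_classical all_reals all_analysis.

Set Implicit Arguments.
Unset Strict Implicit.
Unset Printing Implicit Defensive.

Import Order.TTheory GRing.Theory Num.Theory.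
Import numFieldNormedType.Exports.

Local Open Scope ring_scope.

Definition posdefmx (R : realType) (m : nat) (A : 'M[R]_m) : Prop :=
  A \is symmetricmx /\
  forall x : 'cV[R]_m, x != 0 -> 0 < (x^T *m A *m x) 0 0.

Definition is_minimizer (R : realType) (T : Type) (f : T -> R) (x : T) : Prop :=
  forall y : T, f x <= f y.

Definition complete_laplacian (R : realType) (k : nat) : 'M[R]_k :=
  k%:R *: 1%:M - (const_mx 1 : 'cV[R]_k) *m (const_mx 1 : 'cV[R]_k)^T.

(* [\mxdiag] lives in size [\sum_c n c]; the cast only renames this size [m]. *)
Definition cluster_laplacian (R : realType) (m C : nat) (n : 'I_C -> nat)
    (sum_n : (\sum_(c < C) n c)%N = m) : 'M[R]_m :=
  castmx (sum_n, sum_n) (\mxdiag_(c < C) complete_laplacian R (n c)).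

(* A 1 x 1 product is read as a scalar through its entry [0 0]. *)
Definition cluster_objective (R : realType) (m : nat) (L : 'M[R]_m) (rho : R)
    (theta : 'cV[R]_m) (v : 'cV[R]_m) : R :=
  rho * ((v - theta)^T *m (v - theta)) 0 0 +
  (1 - rho) * (v^T *m L *m v) 0 0.

Definition cluster_matrix (R : realType) (m : nat) (L : 'M[R]_m) (rho : R)
    : 'M[R]_m :=
  1%:M + ((1 - rho) / rho) *: L.

(* Main.v *)
(* Completing the square: with [w := A^-1 theta], the objective is
   [F v = F w + rho * (v - w)^T A (v - w)]. Since [A] is positive definite, this
   one identity yields convexity, and the unique minimizer [w]. The Laplacian
   [L] of a complete graph on [k] vertices is positive semidefinite because
   [L^2 = k L], i.e. [k x^T L x = |L x|^2]. *)

Require Import Defs.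
From HB Require Import structures.
From mathcomp Require Import all_boot all_order all_algebra.
From mathcomp Require Import all_classical all_reals all_analysis.
From mathcomp Require Import ring.

Set Implicit Arguments.
Unset Strict Implicit.
Unset Printing Implicit Defensive.

Import Order.TTheory GRing.Theory Num.Theory.
Import numFieldNormedType.Exports.

Local Open Scope ring_scope.

(** Displays the form as a polynomial in the coordinates of [x], from which differentiability is
    read off. *)
Lemma qformE (R : realType) (m : nat) (A : 'M[R]_m) (x : 'cV[R]_m) :
  (x^T *m A *m x) 0 0 = \sum_i (\sum_j x j 0 * A j i) * x i 0.
Proof.
rewrite mxE; apply: eq_bigr => i _; rewrite mxE; congr (_ * _).
by apply: eq_bigr => j _; rewrite mxE.
Qed.

Lemma sqnormE (R : realType) (m : nat) (x : 'cV[R]_m) :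
  (x^T *m x) 0 0 = \sum_i x i 0 ^+ 2.
Proof. by rewrite mxE; apply: eq_bigr => i _; rewrite mxE expr2. Qed.

Lemma sqnorm_ge0 (R : realType) (m : nat) (x : 'cV[R]_m) :
  0 <= (x^T *m x) 0 0.
Proof. by rewrite sqnormE sumr_ge0// => i _; exact: sqr_ge0. Qed.

Lemma sqnorm_gt0 (R : realType) (m : nat) (x : 'cV[R]_m) :
  x != 0 -> 0 < (x^T *m x) 0 0.
Proof.
move=> x0; rewrite lt_neqAle sqnorm_ge0 andbT; apply: contra x0.
rewrite eq_sym sqnormE psumr_eq0 => [/allP h|i _]; last exact: sqr_ge0.
apply/eqP/matrixP => i j; rewrite ord1 mxE.
by apply/eqP; rewrite -sqrf_eq0; have /= := h i (mem_index_enum _).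
Qed.

(** A 1 x 1 matrix has the same entry as its transpose. *)
Lemma bilin_sym (R : realType) (m : nat) (A : 'M[R]_m) (x y : 'cV[R]_m) :
  A^T = A -> (x^T *m A *m y) 0 0 = (y^T *m A *m x) 0 0.
Proof.
move=> tA; transitivity ((x^T *m A *m y)^T 0 0); first by rewrite [RHS]mxE.
by rewrite !trmx_mul trmxK tA mulmxA.
Qed.

Lemma qformD (R : realType) (m : nat) (A : 'M[R]_m) (x y : 'cV[R]_m) :
  A^T = A ->
  ((x + y)^T *m A *m (x + y)) 0 0 =
  (x^T *m A *m x) 0 0 + 2 * (y^T *m A *m x) 0 0 + (y^T *m A *m y) 0 0.
Proof.
move=> tA; rewrite [(x + y)^T]raddfD/= !(mulmxDl, mulmxDr).
have addE (M N : 'M[R]_1) : (M + N) 0 0 = M 0 0 + N 0 0 by rewrite mxE.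
rewrite !addE (bilin_sym x y tA); ring.
Qed.

Lemma qformZ (R : realType) (m : nat) (A : 'M[R]_m) (a : R) (x : 'cV[R]_m) :
  ((a *: x)^T *m A *m (a *: x)) 0 0 = a ^+ 2 * (x^T *m A *m x) 0 0.
Proof.
by rewrite [(a *: x)^T]linearZ/= -!scalemxAl -scalemxAr scalerA mxE expr2.
Qed.

Lemma tr_complete_laplacian (R : realType) (k : nat) :
  (complete_laplacian R k)^T = complete_laplacian R k.
Proof.
by rewrite /complete_laplacian linearB linearZ/= trmx1 trmx_mul trmxK.
Qed.

(** Since [j^T j = k], the Laplacian [L = k I - j j^T] satisfies [L j = 0], so only [k L] survives
    in [L (k I - j j^T)]. *)
Lemma complete_laplacian_sqr (R : realType) (k : nat) :
  complete_laplacian R k *m complete_laplacian R k =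
  k%:R *: complete_laplacian R k.
Proof.
rewrite /complete_laplacian; set j := const_mx 1.
have jj : j^T *m j = k%:R%:M :> 'M[R]_1.
  apply/matrixP => a b; rewrite !ord1 !mxE eqxx mulr1n.
  rewrite (eq_bigr (fun=> 1)) => [|i _]; last by rewrite !mxE mulr1.
  by rewrite sumr_const card_ord.
rewrite mulmxBr -scalemxAr mulmx1 mulmxBl -scalemxAl mul1mx.
rewrite mulmxA -[j *m j^T *m j]mulmxA jj mul_mx_scalar -scalemxAl.
by rewrite subrr subr0.
Qed.

Lemma complete_laplacian_ge0 (R : realType) (k : nat) (x : 'cV[R]_k) :
  0 <= (x^T *m complete_laplacian R k *m x) 0 0.
Proof.
(* Size 0 is set apart because the factor [k] in [k x^T L x = |L x|^2] must be positive to be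
   cancelled. *)
case: k x => [|k] x; first by rewrite mxE big_ord0.
have k0 : 0 < k.+1%:R :> R by rewrite ltr0n.
rewrite -(pmulr_rge0 _ k0).
have := sqnorm_ge0 (complete_laplacian R k.+1 *m x).
rewrite trmx_mul tr_complete_laplacian mulmxA -(mulmxA _^T).
by rewrite complete_laplacian_sqr -scalemxAr -scalemxAl mxE.
Qed.

Lemma tr_cluster_laplacian (R : realType) (m C : nat) (n : 'I_C -> nat)
    (sum_n : (\sum_(c < C) n c)%N = m) :
  (cluster_laplacian R sum_n)^T = cluster_laplacian R sum_n.
Proof.
rewrite /cluster_laplacian trmx_cast tr_mxdiag /=; congr castmx.
by apply: eq_mxdiag => c; exact: tr_complete_laplacian.
Qed.

Lemma cluster_laplacian_ge0 (R : realType) (m C : nat) (n : 'I_C -> nat)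
    (sum_n : (\sum_(c < C) n c)%N = m) (x : 'cV[R]_m) :
  0 <= (x^T *m cluster_laplacian R sum_n *m x) 0 0.
Proof.
(* Eliminating the size equation turns the cast into the identity; cutting [x] into blocks then
   splits the form into a sum over clusters. *)
rewrite /cluster_laplacian; case: m / sum_n x => x.
rewrite castmx_id -[x]submxcolK tr_mxcol -mulmxA mul_mxdiag_mxcol.
rewrite mul_mxrow_mxcol summxE sumr_ge0// => c _.
by rewrite mulmxA complete_laplacian_ge0.
Qed.

(** A nonzero row of the left kernel would be a nonzero vector on which the form vanishes. *)
Lemma posdefmx_unit (R : realType) (m : nat) (A : 'M[R]_m) :
  posdefmx A -> A \in unitmx.
Proof.
move=> [_ A0]; rewrite -row_free_unit -kermx_eq0; apply/eqP/row_matrixP => i.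
rewrite row0; apply/eqP/negPn/negP => x0.
have := A0 (row i (kermx A))^T; rewrite trmx_eq0 => /(_ x0).
by rewrite trmxK -row_mul mulmx_ker row0 mul0mx mxE ltxx.
Qed.

Lemma posdefmx_cluster_matrix (R : realType) (m : nat) (L : 'M[R]_m) (rho : R) :
  L^T = L -> (forall x : 'cV[R]_m, 0 <= (x^T *m L *m x) 0 0) ->
  0 < rho -> rho <= 1 -> posdefmx (cluster_matrix L rho).
Proof.
move=> tL L0 rho0 rho1; split.
  (* [symmetricmx] is the hermitian predicate with sign [(-1) ^+ 0] and the identity as
     conjugation. *)
  by apply/is_hermitianmxP; rewrite expr0 scale1r map_mx_id//
    /cluster_matrix linearD linearZ/= trmx1 tL.
move=> x x0; rewrite /cluster_matrix mulmxDr mulmxDl mulmx1 -scalemxAr.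
rewrite -scalemxAl mxE ltr_pwDl ?sqnorm_gt0// mxE.
by rewrite mulr_ge0// divr_ge0 ?subr_ge0// ltW.
Qed.

(** With [d = v - w] and [c = (1 - rho) / rho], the equation [A w = theta] gives
    [w - theta = - c L w]. The cross terms [2 rho d^T (w - theta)] and [2 (1 - rho) d^T L w] then
    cancel, as [rho c = 1 - rho]. *)
Lemma cluster_objective_square (R : realType) (m : nat) (L : 'M[R]_m) (rho : R)
    (theta w v : 'cV[R]_m) :
  L^T = L -> rho != 0 -> cluster_matrix L rho *m w = theta ->
  cluster_objective L rho theta v = cluster_objective L rho theta w +
  rho * ((v - w)^T *m cluster_matrix L rho *m (v - w)) 0 0.
Proof.
move=> tL rho0 Aw; rewrite /cluster_objective.
set c := (1 - rho) / rho; set z := - c *: (L *m w).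
have wz : w - theta = z.
  by rewrite -Aw mulmxDl mul1mx -scalemxAl opprD addrA subrr add0r /z scaleNr.
have -> : v = w + (v - w) by rewrite addrC subrK.
move: (v - w) => d; rewrite [w + d - _]addrAC [w + d - w]addrAC subrr add0r wz.
(* Inserting the identity matrix lets [qformD] expand the squared norm as well. *)
have sqE x : x^T *m x = x^T *m 1%:M *m x by rewrite mulmx1.
have dz : (d^T *m z) 0 0 = - c * (d^T *m L *m w) 0 0.
  by rewrite -scalemxAr mxE mulmxA.
have qA : (d^T *m cluster_matrix L rho *m d) 0 0 =
    (d^T *m d) 0 0 + c * (d^T *m L *m d) 0 0.
  by rewrite mulmxDr mulmxDl mulmx1 -scalemxAr -scalemxAl !mxE.
by rewrite !sqE !qformD ?trmx1// !mulmx1 dz qA /c; field.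
Qed.

(** For [q x = x^T A x], the convexity gap is exactly [r s (1 - s) q (x - y)], which is nonnegative;
    the shift by [w] cancels in [x - y]. *)
Lemma convex_shifted_qform (R : realType) (m : nat) (A : 'M[R]_m) (a r : R)
    (w : 'cV[R]_m) :
  A^T = A -> (forall x : 'cV[R]_m, 0 <= (x^T *m A *m x) 0 0) -> 0 <= r ->
  @convex_function R 'cV[R]_m setT
    (fun v => a + r * ((v - w)^T *m A *m (v - w)) 0 0).
Proof.
move=> tA A0 r0 t x y _ _; set s : R := t%:num.
have s0 : 0 <= s by rewrite /s.
have s1 : s <= 1 by rewrite /s.
have -> : conv t x y - w = s *: (x - w) + (1 - s) *: (y - w).
  rewrite (_ : conv t x y = s *: x + (1 - s) *: y :> 'cV[R]_m)//.
  by apply/matrixP => i j; rewrite !mxE; ring.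
rewrite convRE -[X in _ <= _ + X * _]/(1 - s) -/s.
move: (x - w) (y - w) => {}x {}y.
have bZ (k l : R) :
    ((k *: y)^T *m A *m (l *: x)) 0 0 = k * l * (y^T *m A *m x) 0 0.
  by rewrite [(k *: y)^T]linearZ/= -!scalemxAl -scalemxAr scalerA mxE.
(* This is [q (x - y) >= 0], written with explicit scalars so that both sides expand by the same
   rules. *)
have := A0 (1 *: x + (- 1) *: y); rewrite !qformD// !qformZ !bZ.
set X := (x^T *m A *m x) 0 0; set Y := (y^T *m A *m y) 0 0.
set B := (y^T *m A *m x) 0 0 => d0; rewrite -subr_ge0.
rewrite [leRHS](_ : _ = r * s * (1 - s) *
    (1 ^+ 2 * X + 2 * (-1 * 1 * B) + (-1) ^+ 2 * Y)).
  by rewrite !mulr_ge0// subr_ge0.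
rewrite /GRing.scale/=; ring.
Qed.

Lemma differentiable_shifted_qform (R : realType) (m : nat) (A : 'M[R]_m)
    (w v : 'cV[R]_m) :
  differentiable (fun v : 'cV[R]_m => ((v - w)^T *m A *m (v - w)) 0 0 : R) v.
Proof.
have dc i : differentiable (fun v : 'cV[R]_m => (v - w) i 0 : R) v.
  rewrite (_ : (fun _ => _) = (fun v : 'cV[R]_m => v i 0 : R) - cst (w i 0)).
    by apply: differentiableB => //; exact: differentiable_coord.
  by apply/funext => x; rewrite !mxE.
rewrite (_ : (fun _ => _) = \sum_i ((\sum_j ((fun v : 'cV[R]_m => (v - w) j 0)
    * cst (A j i))) * (fun v : 'cV[R]_m => (v - w) i 0))); last first.
  apply/funext => x; rewrite qformE fct_sumE; apply: eq_bigr => i _.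
  by rewrite [RHS]/GRing.mul/= fct_sumE.
apply: differentiable_sum => i; apply: differentiableM => //.
by apply: differentiable_sum => j; apply: differentiableM.
Qed.

Theorem proposition2p1 (R : realType) (m C h : nat) (n : 'I_C -> nat)
    (m_ge1 : (1 <= m)%N) (n_ge1 : forall c : 'I_C, (1 <= n c)%N)
    (sum_n : (\sum_(c < C) n c)%N = m)
    (rho : R) (rho_gt0 : 0 < rho) (rho_le1 : rho <= 1)
    (mu : 'cV[R]_m) (Z : 'M[R]_(m, h)) (u : 'cV[R]_h) :
  let L_SC := cluster_laplacian R sum_n in
  let theta := mu + Z *m u in
  let F := cluster_objective L_SC rho theta in
  let A := cluster_matrix L_SC rho in
  [/\ @convex_function R 'cV[R]_m setT F,
      forall v : 'cV[R]_m, differentiable F v,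
      posdefmx A,
      A \in unitmx &
      forall v : 'cV[R]_m, is_minimizer F v <-> v = invmx A *m theta].
Proof.
move=> L theta F A.
have tL : L^T = L by exact: tr_cluster_laplacian.
have Apos : posdefmx A.
  by apply: posdefmx_cluster_matrix => //; exact: cluster_laplacian_ge0.
have tA : A^T = A by rewrite /A /cluster_matrix linearD linearZ/= trmx1 tL.
have A0 (x : 'cV[R]_m) : 0 <= (x^T *m A *m x) 0 0.
  have [->|/(proj2 Apos)/ltW//] := eqVneq x 0.
  by rewrite mulmx0 mxE.
have Aunit := posdefmx_unit Apos.
set w := invmx A *m theta.
(* Convexity, differentiability and the minimizer are all read off this form of [F]. *)
have FE : F = fun v => F w + rho * ((v - w)^T *m A *m (v - w)) 0 0.
  apply/funext => v; apply: cluster_objective_square => //.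
    by rewrite gt_eqF.
  by rewrite mulKVmx.
split=> //.
- by rewrite FE; apply: convex_shifted_qform => //; exact: ltW.
- move=> v; rewrite FE.
  have dq := differentiable_shifted_qform A w v.
  exact: (differentiableD (differentiable_cst _ _) (differentiableZ rho dq)).
- move=> v; split=> [Fv|->]; last first.
    (* [F] occurs on both sides of [FE], which is therefore applied at a single point, leaving [F w]
       intact. *)
    by move=> y; rewrite [leRHS](congr1 (@^~ y) FE) lerDl mulr_ge0// ltW.
  (* Uniqueness: if [v != w], then [F v] exceeds [F w] by a positive amount, against the minimality
     of [v]. *)
  apply/eqP; rewrite -subr_eq0; apply/negPn/negP => /(proj2 Apos) vw0.
  have := Fv w; rewrite [leLHS](congr1 (@^~ v) FE) gerDl.
  by rewrite leNgt mulr_gt0.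
Qed.
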